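(* Let $w\in A^*$ be a word of length $n$, and let $l^*$ be the adjoint of the left normed Lie bracketing of the free Lie ring. Write $l^*(w)=\sum_{i=1}^k\xi_i\,l^*(l_i)$ with $\xi_i\in\mathbb{Z}$, where $l_1,\dots,l_k$ are the Lyndon words of length $n$. Then either $c(w)=0$, or $c(w)$ equals the greatest common divisor of the nonzero coefficients of the monomials of $l^*(w)$, and also equals the greatest common divisor of the nonzero $\xi_i$.
   Context: $A$ is a finite totally ordered alphabet, ordered lexicographically on $A^*$; a nonempty word is a Lyndon word if it is strictly smaller than each of its proper nontrivial rotations (equivalently, than each of its proper nonempty suffixes). $\mathbb{Z}\langle A\rangle$ is the free associative ring with scalar product $(P,Q)=\sum_u(P,u)(Q,u)$, $(P,u)$ being the coefficient of $u$ in $P$. The free Lie ring $\mathcal{L}_{\mathbb{Z}}(A)$ is the Lie subring (bracket $[P,Q]=PQ-QP$) generated by $A$. The left normed bracketing $l$: $l(\epsilon)=0$, $l(a)=a$, $l(ua)=[l(u),a]$, extended linearly; $l^*$ is the linear endomorphism with $(l^*(u),v)=(l(v),u)$ for all words $u,v$. The elements $l^*(l_1),\dots,l^*(l_k)$ form a $\mathbb{Z}$-basis of the image under $l^*$ of the degree-$n$ homogeneous component, so the $\xi_i$ exist and are unique. $c(w)$ is the non-negative generator of the ideal $\{(P,w):P\in\mathcal{L}_{\mathbb{Z}}(A)\}$ of $\mathbb{Z}$. *)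

(* Defs.v *)
From Stdlib Require Import Classical ClassicalEpsilon.
From HB Require Import structures.
From mathcomp Require Import all_boot all_order all_algebra.
From mathcomp Require Import finmap monalg.

Set Implicit Arguments.
Unset Strict Implicit.
Unset Printing Implicit Defensive.

Import Order.TTheory GRing.Theory Num.Theory.
Local Open Scope ring_scope.

Section Lyndon.
Context {d : Order.disp_t} {A : finOrderType d}.

(* The proper nontrivial rotations of w = uv (u, v nonempty) are the words
   vu = rot i w with 0 < i < size w. Such a rotation may be equal to w as a
   word, e.g. for w = aa; then w is not Lyndon. *)
Definition lyndon (w : seq A) : bool :=
  (w != [::]) &&
  [forall i : 'I_(size w), (0 < i)%N ==> (w < rot i w :> seqlexi A)%O].

End Lyndon.

(* Z<A>: {fmonom A} is the free monoid A^*, built from words by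
   FMonom : seq A -> {fmonom A}. *)
Notation freeRing A := {malg int[{fmonom A}]}.

Section FreeRing.
Context {A : finType}.
Implicit Types (P Q : freeRing A) (u v w : seq A) (a : A).

Definition word w : freeRing A := << FMonom w >>.

Definition scalar_prod P Q : int := \sum_(u <- msupp P) P@_u * Q@_u.

Definition bracket P Q : freeRing A := P * Q - Q * P.

Inductive free_lie : freeRing A -> Prop :=
| free_lie_letter a : free_lie (word [:: a])
| free_lie_zero : free_lie 0
| free_lie_sub P Q : free_lie P -> free_lie Q -> free_lie (P - Q)
| free_lie_bracket P Q : free_lie P -> free_lie Q -> free_lie (bracket P Q).

Definition lin_ext (f : seq A -> freeRing A) P : freeRing A :=
  \sum_(u <- msupp P) P@_u *: f u.

Definition left_bracketing_word w : freeRing A :=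
  if w is a :: u
  then foldl (fun P b => bracket P (word [:: b])) (word [:: a]) u
  else 0.

Definition left_bracketing := lin_ext left_bracketing_word.

(* l is homogeneous, so (l(v), u) = 0 unless v has the length of u, and the sum
   of (l(v), u) v over all words v reduces to the words of that length. The
   defining property of the adjoint is left_bracketing_adjP below. *)
Definition left_bracketing_adj_word u : freeRing A :=
  \sum_(v : (size u).-tuple A)
    scalar_prod (left_bracketing (word v)) (word u) *: word v.

Definition left_bracketing_adj := lin_ext left_bracketing_adj_word.

Definition is_nonneg_generator (I : int -> Prop) (c : int) : Prop :=
  0 <= c /\ forall x : int, I x <-> (c %| x)%Z.

Definition lie_coef_ideal w (x : int) : Prop :=
  exists2 P : freeRing A, free_lie P & scalar_prod P (word w) = x.

(* The generator exists and is unique: see lie_coef_genP and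
   nonneg_generator_unique below. *)
Definition lie_coef_gen w : int :=
  epsilon (inhabits 0) (is_nonneg_generator (lie_coef_ideal w)).

Lemma scalar_prod_word P w : scalar_prod P (word w) = P@_(FMonom w).
Proof.
rewrite [in RHS](monalgE P) raddf_sum; apply: eq_bigr => u _ /=.
by rewrite /word !mcoeffU eq_sym mulr_natr.
Qed.

Lemma scalar_prodC P Q : scalar_prod P Q = scalar_prod Q P.
Proof.
have E (P' Q' : freeRing A) : scalar_prod P' Q' =
    \sum_(u <- (msupp P' `|` msupp Q')%fset) P'@_u * Q'@_u.
  apply: big_fset_incl; first exact: fsubsetUl.
  by move=> u _ /mcoeff_outdom ->; rewrite mul0r.
rewrite !E fsetUC; apply: eq_bigr => u _; exact: mulrC.
Qed.

Lemma lin_extw f P (D : {fset {fmonom A}}) :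
  (msupp P `<=` D)%fset -> lin_ext f P = \sum_(u <- D) P@_u *: f u.
Proof.
move=> sPD; apply: big_fset_incl => // u _ /mcoeff_outdom ->.
by rewrite scale0r.
Qed.

Lemma lin_ext_is_linear f : linear (lin_ext f).
Proof.
move=> a P Q; set D := (msupp P `|` msupp Q)%fset.
have sP : (msupp P `<=` D)%fset by exact: fsubsetUl.
have sQ : (msupp Q `<=` D)%fset by exact: fsubsetUr.
have sR : (msupp (a *: P + Q) `<=` D)%fset.
  apply: (fsubset_trans (msuppD_le _ _)); apply: fsetSU; exact: msuppZ_le.
rewrite (lin_extw f sP) (lin_extw f sQ) (lin_extw f sR) scaler_sumr -big_split.
by apply: eq_bigr => u _; rewrite mcoeffD mcoeffZ scalerDl scalerA.
Qed.

HB.instance Definition _ f :=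
  GRing.isLinear.Build int (freeRing A) (freeRing A) *:%R (lin_ext f)
    (lin_ext_is_linear f).
HB.instance Definition _ := GRing.Linear.on left_bracketing.
HB.instance Definition _ := GRing.Linear.on left_bracketing_adj.

Lemma lin_ext_word f w : lin_ext f (word w) = f w.
Proof. by rewrite /lin_ext msuppU1 big_seq_fset1 mcoeffUU scale1r. Qed.

Lemma left_bracketing0 : left_bracketing (word [::]) = 0.
Proof. by rewrite /left_bracketing lin_ext_word. Qed.

Lemma left_bracketing1 a : left_bracketing (word [:: a]) = word [:: a].
Proof. by rewrite /left_bracketing lin_ext_word. Qed.

Lemma left_bracketing_rcons u a : u != [::] ->
  left_bracketing (word (rcons u a)) =
  bracket (left_bracketing (word u)) (word [:: a]).
Proof.
by rewrite /left_bracketing !lin_ext_word; case: u => //= b u _; rewrite foldl_rcons.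
Qed.

Lemma bracket_homog m n P Q :
  (forall u : {fmonom A}, u \in msupp P -> size u = m) ->
  (forall u : {fmonom A}, u \in msupp Q -> size u = n) ->
  forall u : {fmonom A}, u \in msupp (bracket P Q) -> size u = (m + n)%N.
Proof.
move=> hP hQ u /(fsubsetP (msuppB_le _ _)); rewrite in_fsetU.
case/orP => /msuppM_le [u1 [u2 [h1 h2 ->]]]; rewrite fmM size_cat.
  by rewrite (hP _ h1) (hQ _ h2).
by rewrite (hQ _ h1) (hP _ h2) addnC.
Qed.

Lemma left_bracketing_homog v (u : {fmonom A}) :
  u \in msupp (left_bracketing (word v)) -> size u = size v.
Proof.
elim/last_ind: v u => [|v a IH] u; first by rewrite left_bracketing0 msupp0.
have [->|v0] := eqVneq v [::].
  by rewrite left_bracketing1 /word msuppU1 in_fset1 => /eqP ->.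
rewrite left_bracketing_rcons // size_rcons -addn1.
apply: bracket_homog => // x.
by rewrite /word msuppU1 in_fset1 => /eqP ->.
Qed.

Lemma left_bracketing_adjP u v :
  scalar_prod (left_bracketing_adj (word u)) (word v) =
  scalar_prod (left_bracketing (word v)) (word u).
Proof.
rewrite [LHS]scalar_prod_word /left_bracketing_adj lin_ext_word.
rewrite /left_bracketing_adj_word raddf_sum /=.
have [/eqP sv|sv] := boolP (size v == size u).
  have sv' : size v == size u by apply/eqP.
  rewrite (bigD1 (Tuple sv')) //= mcoeffZ mcoeffUU mulr1 big1 ?addr0 //.
  move=> t; rewrite -val_eqE /= => /negbTE tv; rewrite mcoeffZ /word mcoeffU.
  by rewrite -val_eqE /= tv mulr0.
rewrite big1; last first.
  move=> t _; rewrite mcoeffZ /word mcoeffU -val_eqE /=.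
  case: eqP => [tv|_]; last by rewrite mulr0.
  by move: sv; rewrite -tv size_tuple eqxx.
rewrite scalar_prod_word mcoeff_outdom //.
by apply: contra sv => /left_bracketing_homog /= <-.
Qed.

Lemma nonneg_generator_unique I c c' :
  is_nonneg_generator I c -> is_nonneg_generator I c' -> c = c'.
Proof.
move=> [c0 hc] [c'0 hc'].
have h1 : (c %| c')%Z by apply/hc/hc'; rewrite dvdzz.
have h2 : (c' %| c)%Z by apply/hc'/hc; rewrite dvdzz.
rewrite -(gez0_abs c0) -(gez0_abs c'0); congr Posz.
by apply/eqP; rewrite eqn_dvd; apply/andP.
Qed.

Lemma nonneg_generator_exists (I : int -> Prop) :
  I 0 -> (forall x y, I x -> I y -> I (x - y)) ->
  exists c, is_nonneg_generator I c.
Proof.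
move=> I0 IB.
have IN x : I x -> I (- x) by move=> Ix; rewrite -[- x]add0r; apply: IB.
have ID x y : I x -> I y -> I (x + y).
  by move=> Ix Iy; rewrite -[y]opprK; apply: IB => //; apply: IN.
have IMn x n : I x -> I (x *+ n).
  by move=> Ix; elim: n => [|n IH]; rewrite ?mulr0n // mulrS; apply: ID.
have IM x q : I x -> I (q * x).
  move=> Ix; case: q => n; first by rewrite mulrC -mulrzz -pmulrn; apply: IMn.
  by rewrite NegzE mulNr mulrC -mulrzz -pmulrn; apply/IN/IMn.
have [[m m0 Im]|no] := classic (exists2 m : nat, (0 < m)%N & I m%:Z); last first.
  exists 0; split=> // x; rewrite dvd0z; split=> [Ix|/eqP -> //].
  apply/eqP; case: (intP x) Ix => // n Ix; case: no; exists n.+1 => //.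
  by move/IN: Ix; rewrite opprK.
have [c [c0 [Ic cmin]]] : exists c : nat, (0 < c)%N /\ (I c%:Z /\
    forall k : nat, (0 < k < c)%N -> ~ I k%:Z).
  elim/ltn_ind: m m0 Im => m IH m0 Im.
  have [[k kP Ik]|no] := classic (exists2 k : nat, (0 < k < m)%N & I k%:Z).
    by case/andP: kP => k0 km; apply: (IH k).
  by exists m; split=> //; split=> // k kP Ik; apply: no; exists k.
exists c%:Z; split=> // x; split=> [Ix|/dvdzP [q ->]]; last exact: IM.
have cn0 : c%:Z != 0 by rewrite eqz_nat -lt0n.
have Ir : I (x %% c)%Z by rewrite /modz; apply: IB => //; apply: IM.
apply/dvdz_mod0P; move: Ir (modz_ge0 x cn0) (ltz_pmod x (c0 : 0 < c%:Z)).
case: (x %% c)%Z => // -[|k] // Ik _; rewrite ltz_nat => kc.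
by case: (cmin k.+1).
Qed.

Lemma lie_coef_genP w :
  is_nonneg_generator (lie_coef_ideal w) (lie_coef_gen w).
Proof.
apply: epsilon_spec; apply: nonneg_generator_exists.
  by exists 0; [exact: free_lie_zero | rewrite scalar_prod_word mcoeff0].
move=> _ _ [P hP <-] [Q hQ <-]; exists (P - Q); first exact: free_lie_sub.
by rewrite !scalar_prod_word mcoeffB.
Qed.

End FreeRing.

(* Main.v *)
(* By the Jacobi identity the image of the left normed bracketing l is closed
   under brackets, so every Lie polynomial is some l(Q). Since
   (l(Q), w) = (Q, l^*(w)), c(w) is the gcd of the coefficients of l^*(w).
   In particular gcd(xi_i) divides c(w). Conversely, each Lyndon word s is the
   least word of a homogeneous Lie polynomial P_s, with coefficient 1 (bracket
   along a factorization of s into Lyndon words). Pairing P_s = l(Q) with w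
   gives (P_s, w) = sum_i xi_i (P_s, l_i) = xi_s + sum_(l_i > s) xi_i (P_s, l_i),
   and c(w) divides the left side, so c(w) divides every xi_s, by induction from
   the largest s down. *)
Require Import Defs.
From mathcomp Require Import all_boot all_order all_algebra.
From mathcomp Require Import ssrAC finmap monalg.
Import Order.TTheory GRing.Theory Num.Theory.
Local Open Scope ring_scope.

Set Implicit Arguments.
Unset Strict Implicit.
Unset Printing Implicit Defensive.

(** * Lexicographic order and suffixes of Lyndon words *)

Section Words.
Context {d : Order.disp_t} {A : finOrderType d}.
Implicit Types s u v x y : seq A.
Local Notation "u <l v" := (u < v :> seqlexi A)%O (at level 70).
Local Notation "u <=l v" := (u <= v :> seqlexi A)%O (at level 70).

Lemma ltxi_cat2l x u v : (x ++ u <l x ++ v) = (u <l v).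
Proof. by elim: x => //= a x IH; rewrite ltxi_cons lexx. Qed.

Lemma lexi_catr u v : u <=l u ++ v.
Proof. by elim: u => //= a u IH; rewrite lexi_cons lexx. Qed.

(** The first difference lies inside both [u] and [v], so the words appended to them do not
    matter. *)
Lemma ltxi_cat u v x y : ~~ prefix u v -> u <l v -> u ++ x <l v ++ y.
Proof.
elim: u v => [|a u IH] [|b v] //=; rewrite !ltxi_cons.
move=> np /andP[ab]; rewrite ab /=; case: (boolP (b <= a)%O) => //= ba.
have eab : a = b by apply/le_anti; rewrite ab.
by rewrite eab eqxx /= in np; apply: IH.
Qed.

Lemma ltxi_cat_inv u v x y : ~~ prefix v u -> u ++ x <l v ++ y -> u <l v.
Proof.
move=> np h; rewrite ltNge; apply/negP; rewrite le_eqVlt => /orP[/eqP vu|vu].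
  by rewrite vu prefix_refl in np.
by have := lt_trans h (ltxi_cat y x np vu); rewrite ltxx.
Qed.

Lemma eqsize_prefix u v : size u = size v -> prefix u v -> u = v.
Proof. by move=> suv; rewrite prefixE suv take_size => /eqP. Qed.

Lemma ltxi_cat_eqsize u v x y :
  size u = size v -> u <l v -> u ++ x <l v ++ y.
Proof.
move=> suv uv; apply: ltxi_cat => //; apply/negP => /(eqsize_prefix suv) e.
by rewrite e ltxx in uv.
Qed.

Definition lt_suffixes s : Prop :=
  s <> [::] /\ forall u v, s = u ++ v -> u <> [::] -> v <> [::] -> s <l v.

(** If the suffix [v] is not a prefix of [s], then [s < v ++ u] is decided inside [v]. Otherwise
    [s = u ++ v = v ++ x]: the rotation [v ++ u] gives [x < u], so [x ++ v < u ++ v = s], against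
    the rotation [x ++ v]. *)
Lemma lyndon_lt_suffixes s : lyndon s -> lt_suffixes s.
Proof.
case/andP => /eqP s0 /forallP rot_s; split=> // u v suv u0 v0.
have lt_rot x y : s = x ++ y -> x <> [::] -> y <> [::] -> s <l y ++ x.
  move=> sxy /eqP x0 /eqP y0.
  have xs : (size x < size s)%N.
    by rewrite sxy size_cat -addn1 leq_add2l lt0n size_eq0.
  have := rot_s (Ordinal xs).
  by rewrite /= lt0n size_eq0 x0 /= {2}sxy rot_size_cat.
have [/prefixP[x sx]|npre] := boolP (prefix v s); last first.
  by apply: (ltxi_cat_inv (x := [::]) (y := u) npre); rewrite cats0; apply: lt_rot.
have sux : size u = size x.
  have : size (u ++ v) = size (v ++ x) by rewrite -suv -sx.
  by rewrite !size_cat addnC => /addnI.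
have x0 : x <> [::] by move=> x0; rewrite x0 in sux; case: u sux u0 {suv}.
have h1 : x <l u by rewrite -(ltxi_cat2l v) -sx; apply: lt_rot.
have h2 := lt_rot v x sx v0 x0.
by have := lt_trans h2 (ltxi_cat_eqsize v v (esym sux) h1); rewrite -suv ltxx.
Qed.

(* [v] is the least proper suffix of [s]. A proper suffix [u'] of [u] which is
   also a prefix of [u] would satisfy u' < v < u'v, so that v = u'y with
   y < v, while y is a proper suffix of [s]. *)
Lemma lt_suffixes_factor s : lt_suffixes s -> (1 < size s)%N ->
  exists u v, [/\ s = u ++ v, lt_suffixes u, lt_suffixes v & s <l v ++ u].
Proof.
move=> [s0 hs] s1.
case: (@arg_minP _ (seqlexi A) _ (Ordinal s1) (fun i => 0 < i)%N
  (fun i => drop i s : seqlexi A)) => // i i0 imin.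
have {}imin x y : s = x ++ y -> x <> [::] -> y <> [::] -> drop i s <=l y.
  move=> sxy /eqP x0 /eqP y0.
  have xs : (size x < size s)%N.
    by rewrite sxy size_cat -addn1 leq_add2l lt0n size_eq0.
  have := imin (Ordinal xs); rewrite /= lt0n size_eq0 x0 => /(_ isT).
  by have -> : drop (size x) s = y by rewrite sxy drop_size_cat.
exists (take i s), (drop i s); move: imin.
have suv := esym (cat_take_drop i s).
have u0 : take i s <> [::].
  by move/eqP; rewrite -size_eq0 size_takel ?(ltnW (ltn_ord i)) // -leqn0 leqNgt i0.
have v0 : drop i s <> [::].
  by move/eqP; rewrite -size_eq0 size_drop subn_eq0 leqNgt ltn_ord.
move: (take i s) (drop i s) suv u0 v0 => u v suv u0 v0 vmin {i i0 s1}.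
have sv : s <l v by apply: hs suv u0 v0.
split=> //; last exact: lt_le_trans sv (lexi_catr _ _).
  split=> // p q upq p0 q0.
  have spqv : s = p ++ (q ++ v) by rewrite suv upq catA.
  have qv0 : q ++ v <> [::] by case: (q) q0.
  have [/prefixP[x ux]|npre] := boolP (prefix q u); last first.
    by apply: (ltxi_cat_inv (x := v) (y := v) npre); rewrite -suv; apply: hs spqv _ _.
  have qv : q <l v.
    by apply: le_lt_trans sv; rewrite suv ux -catA; apply: lexi_catr.
  have vqv : v <=l q ++ v by apply: vmin spqv p0 qv0.
  have [/prefixP[y vqy]|npre] := boolP (prefix q v); last first.
    by have := ltxi_cat v [::] npre qv; rewrite cats0 ltNge vqv.
  have y0 : y <> [::] by move=> y0; rewrite vqy y0 cats0 ltxx in qv.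
  have yv : v <=l y.
    by apply: vmin (_ : s = (u ++ q) ++ y) _ y0; [rewrite -catA -vqy|case: (u) u0].
  move: vqv; rewrite le_eqVlt => /orP[/eqP vqv|].
    have : size v = size (q ++ v) by rewrite -vqv.
    rewrite size_cat -[LHS]add0n => /addIn/esym/eqP.
    by rewrite size_eq0 => /eqP.
  by rewrite {1}vqy ltxi_cat2l ltNge yv.
(* A proper suffix of [v] is also one of [s], hence at least [v]; lengths exclude equality. *)
split=> // p q vpq p0 q0.
have : v <=l q.
  by apply: (vmin (u ++ p)) => //; [rewrite -catA -vpq | case: (u) u0].
rewrite le_eqVlt => /orP[/eqP e|//]; case: p0; apply/eqP; rewrite -size_eq0.
have : size v = size (p ++ q) by rewrite -vpq.
by rewrite size_cat -e -[LHS]add0n => /addIn/esym/eqP.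
Qed.

End Words.

(** * Lie polynomials as images under the left normed bracketing *)

Lemma commutator_jacobi (R : pzRingType) (x y z : R) :
  x * (y * z - z * y) - (y * z - z * y) * x =
  (x * y - y * x) * z - z * (x * y - y * x) -
  ((x * z - z * x) * y - y * (x * z - z * x)).
Proof.
rewrite !mulrBl !mulrBr !mulrA !opprB !addrA.
(* The pairs [2*5] and [4*7] are the cancelling terms in [yxz] and [zxy]. *)
by rewrite [RHS](ACl (1*8*3*6*(2*5)*(4*7))) /= !addNr !addr0.
Qed.

Section LieImage.
Context {A : finType}.
Implicit Types (P Q S : freeRing A) (u v w : seq A).

Definition in_image_left_bracketing P : Prop := exists Q, P = left_bracketing Q.
Local Notation in_image := in_image_left_bracketing.

Lemma in_image_sum (I : Type) (r : seq I) (c : I -> int) (F : I -> freeRing A) :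
  (forall i, in_image (F i)) -> in_image (\sum_(i <- r) c i *: F i).
Proof.
move=> hF; elim: r => [|i r [Q IH]]; first by exists 0; rewrite big_nil linear0.
have [P eP] := hF i.
by exists (c i *: P + Q); rewrite big_cons IH eP linearP.
Qed.

Lemma left_bracketingE Q : left_bracketing Q =
  \sum_(u <- msupp Q) Q@_u *: left_bracketing (word u).
Proof.
by apply: eq_bigr => u _; rewrite /left_bracketing lin_ext_word.
Qed.

Lemma bracket_suml (I : Type) (r : seq I) (c : I -> int) (F : I -> freeRing A) Q :
  bracket (\sum_(i <- r) c i *: F i) Q = \sum_(i <- r) c i *: bracket (F i) Q.
Proof.
rewrite /bracket mulr_suml mulr_sumr -sumrB; apply: eq_bigr => i _.
by rewrite -[c i]intz !scaler_int mulrzAl mulrzAr mulrzBl.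
Qed.

Lemma bracketN P Q : bracket P Q = - bracket Q P.
Proof. by rewrite /bracket opprB. Qed.

Lemma bracket_sumr (I : Type) (r : seq I) (c : I -> int) (F : I -> freeRing A) Q :
  bracket Q (\sum_(i <- r) c i *: F i) = \sum_(i <- r) c i *: bracket Q (F i).
Proof.
rewrite bracketN bracket_suml -sumrN; apply: eq_bigr => i _.
by rewrite -scalerN -bracketN.
Qed.

Lemma bracket_jacobi P Q S :
  bracket P (bracket Q S) = bracket (bracket P Q) S - bracket (bracket P S) Q.
Proof. exact: commutator_jacobi. Qed.

Lemma in_image_bracket_letter P (a : A) :
  in_image P -> in_image (bracket P (word [:: a])).
Proof.
case=> Q ->; rewrite left_bracketingE bracket_suml; apply: in_image_sum => u.
have [->|u0] := eqVneq (u : seq A) [::].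
  by exists 0; rewrite left_bracketing0 /bracket mul0r mulr0 subrr linear0.
by exists (word (rcons u a)); rewrite left_bracketing_rcons.
Qed.

Lemma in_imageB P Q : in_image P -> in_image Q -> in_image (P - Q).
Proof. by move=> [P' ->] [Q' ->]; exists (P' - Q'); rewrite linearB. Qed.

(** Induction on [v] for [Q = l(v)]: Jacobi turns [[P, [l(v), a]]] into [[[P, l(v)], a] - [[P, a],
    l(v)]]. The second term replaces [P] by [[P, a]], so [P] must stay general. *)
Lemma in_image_bracket P Q : in_image P -> in_image Q -> in_image (bracket P Q).
Proof.
move=> iP [Q' ->]; rewrite left_bracketingE bracket_sumr; apply: in_image_sum.
move=> u; move: (u : seq A) => {Q'}v; elim/last_ind: v P iP => [|v a IH] P iP.
  by exists 0; rewrite left_bracketing0 /bracket mul0r mulr0 subrr linear0.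
have [->|v0] := eqVneq v [::].
  by rewrite left_bracketing1; apply: in_image_bracket_letter.
rewrite left_bracketing_rcons // bracket_jacobi; apply: in_imageB.
  by apply: in_image_bracket_letter; apply: IH.
by apply: IH; apply: in_image_bracket_letter.
Qed.

Lemma free_lie_in_image P : free_lie P -> in_image P.
Proof.
elim=> [a||P' Q _ iP _ iQ|P' Q _ iP _ iQ].
- by exists (word [:: a]); rewrite left_bracketing1.
- by exists 0; rewrite linear0.
- exact: in_imageB.
- exact: in_image_bracket.
Qed.

Lemma free_lie_left_bracketing_word u : free_lie (left_bracketing (word u)).
Proof.
elim/last_ind: u => [|u a IH]; first by rewrite left_bracketing0; constructor.
have [->|u0] := eqVneq u [::]; first by rewrite left_bracketing1; constructor.
by rewrite left_bracketing_rcons //; do !constructor.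
Qed.

Lemma coef_left_bracketing Q w : (left_bracketing Q)@_(FMonom w) =
  \sum_(u <- msupp Q) Q@_u * (left_bracketing_adj (word w))@_u.
Proof.
rewrite left_bracketingE raddf_sum; apply: eq_bigr => u _ /=.
by rewrite mcoeffZ -scalar_prod_word -left_bracketing_adjP scalar_prod_word fmK.
Qed.

Lemma lie_coef_gen_dvd P w : free_lie P -> (lie_coef_gen w %| P@_(FMonom w))%Z.
Proof.
move=> LP; apply/(lie_coef_genP w).2; exists P => //.
exact: scalar_prod_word.
Qed.

(** By adjointness this coefficient is that of [w] in the Lie polynomial [l(u)]. *)
Lemma lie_coef_gen_dvd_adj w u :
  (lie_coef_gen w %| (left_bracketing_adj (word w))@_(FMonom u))%Z.
Proof.
rewrite -scalar_prod_word left_bracketing_adjP scalar_prod_word.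
by apply/lie_coef_gen_dvd/free_lie_left_bracketing_word.
Qed.

(** The generator lies in its ideal, so it is [(l(Q), w) = (Q, l^*(w))] for some [Q], an integer
    combination of coefficients of [l^*(w)]. *)
Lemma dvdz_lie_coef_gen (g : int) w :
  (forall u : {fmonom A}, (g %| (left_bracketing_adj (word w))@_u)%Z) ->
  (g %| lie_coef_gen w)%Z.
Proof.
move=> hg; have [P LP <-] : lie_coef_ideal w (lie_coef_gen w).
  by apply/(lie_coef_genP w).2.
have [Q ->] := free_lie_in_image LP; rewrite scalar_prod_word coef_left_bracketing.
by apply: rpred_sum => u _; rewrite dvdz_mull.
Qed.

End LieImage.

(** * Lie polynomials with a prescribed Lyndon word as least word *)

Section LyndonLie.
Context {d : Order.disp_t} {A : finOrderType d}.
Implicit Types (s u v : seq A) (P Q : freeRing A).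

(** Meant for the remainder [R] of a homogeneous polynomial [word s + R] with least word [s] and
    leading coefficient 1. *)
Definition supp_gt s P : Prop :=
  forall x : {fmonom A}, x \in msupp P ->
    size x = size s /\ (s < (x : seq A) :> seqlexi A)%O.

Lemma supp_gtD s P Q : supp_gt s P -> supp_gt s Q -> supp_gt s (P + Q).
Proof.
move=> hP hQ x /(fsubsetP (msuppD_le _ _)); rewrite in_fsetU.
by case/orP; [apply: hP | apply: hQ].
Qed.

Lemma supp_gtN s P : supp_gt s P -> supp_gt s (- P).
Proof. by move=> hP x; rewrite msuppN; apply: hP. Qed.

Lemma supp_gt_wordM u v Q : supp_gt v Q -> supp_gt (u ++ v) (word u * Q).
Proof.
move=> hQ x /msuppM_le [x1 [x2 [+ /hQ[s2 l2] ->]]].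
rewrite /word msuppU1 in_fset1 => /eqP ->; rewrite fmM !size_cat s2 /=.
by rewrite ltxi_cat2l.
Qed.

Lemma supp_gtM u v P Q : supp_gt u P ->
  (forall x, x \in msupp Q -> size x = size v) -> supp_gt (u ++ v) (P * Q).
Proof.
move=> hP hQ x /msuppM_le [x1 [x2 [/hP[s1 l1] /hQ s2 ->]]].
by rewrite fmM !size_cat s1 s2; split=> //; apply: ltxi_cat_eqsize.
Qed.

Lemma supp_gt_word_size s R x : supp_gt s R -> x \in msupp (word s + R) ->
  size x = size s /\ (s <= (x : seq A) :> seqlexi A)%O.
Proof.
move=> hR /(fsubsetP (msuppD_le _ _)); rewrite in_fsetU => /orP[].
  by rewrite /word msuppU1 in_fset1 => /eqP ->.
by move=> /hR[-> /ltW].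
Qed.

Lemma word_cat u v : word (u ++ v) = word u * word v :> freeRing A.
Proof.
rewrite /word; transitivity (<< mmul (FMonom u) (FMonom v) >> : freeRing A).
  by congr (<< _ >>); apply/val_inj; rewrite /= fmM.
by rewrite malgME !msuppU1 !big_seq_fset1 !mcoeffUU mulr1.
Qed.

(** Factor [s = u ++ v] and bracket the polynomials obtained for [u] and [v]. Their product has
    least word [s], with coefficient 1; the reversed product only has words at least [v ++ u], which
    exceeds [s]. *)
Lemma lyndon_lie s : lt_suffixes s ->
  exists2 R, supp_gt s R & free_lie (word s + R).
Proof.
have [n] := ubnP (size s); elim: n s => // n IH s sn hs.
have [s1|s1] := leqP (size s) 1.
  exists 0; first by move=> x; rewrite msupp0.
  by case: s s1 hs {sn} => [|a []] // _ [] // _ _; rewrite addr0; constructor.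
have [u [v [suv hu hv lvu]]] := lt_suffixes_factor hs s1.
have u0 : (0 < size u)%N by rewrite lt0n size_eq0; apply/eqP; case: hu.
have v0 : (0 < size v)%N by rewrite lt0n size_eq0; apply/eqP; case: hv.
have suvn : (size u + size v <= n)%N by rewrite -size_cat -suv.
have [|R hR LR] := IH u _ hu.
  by apply: leq_trans suvn; rewrite -[X in (X < _)%N]addn0 ltn_add2l.
have [|S hS LS] := IH v _ hv.
  by apply: leq_trans suvn; rewrite -[X in (X < _)%N]add0n ltn_add2r.
have gtvu : supp_gt s ((word v + S) * (word u + R)).
  move=> x /msuppM_le [x1 [x2 [/(supp_gt_word_size hS)[s1' l1]]]].
  move=> /(supp_gt_word_size hR)[s2 l2] ->.
  rewrite fmM suv !size_cat s1' s2 addnC; split=> //.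
  rewrite -suv; apply: lt_le_trans lvu _.
  move: l1; rewrite le_eqVlt => /orP[/eqP <-|l1].
    move: l2; rewrite le_eqVlt => /orP[/eqP <- //|l2].
    by apply/ltW; rewrite ltxi_cat2l.
  by apply/ltW/ltxi_cat_eqsize.
(* The expanded bracket without its leading term [word u * word v]. *)
exists (word u * S + R * (word v + S) - (word v + S) * (word u + R)).
  apply: supp_gtD; last exact: supp_gtN.
  rewrite suv; apply: supp_gtD; first exact: supp_gt_wordM.
  by apply: supp_gtM => // x /(supp_gt_word_size hS)[].
have -> : word s + (word u * S + R * (word v + S) -
    (word v + S) * (word u + R)) = bracket (word u + R) (word v + S).
  by rewrite suv word_cat /bracket (mulrDl (word u) R) (mulrDr (word u)) 2!addrA.
by constructor.
Qed.

End LyndonLie.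

(** * Greatest common divisors and the Lyndon coordinates *)

Lemma dvdz_biggcd (I : Type) (r : seq I) (P : pred I) (F : I -> int) (g : int) :
  (g %| \big[gcdz/0]_(i <- r | P i) F i)%Z =
  all (fun i => P i ==> (g %| F i)%Z) r.
Proof.
elim: r => [|i r IH]; first by rewrite big_nil dvdz0.
by rewrite big_cons /= -IH; case: (P i); rewrite //= dvdz_gcd.
Qed.

Lemma biggcd_ge0 (I : Type) (r : seq I) (P : pred I) (F : I -> int) :
  0 <= \big[gcdz/0]_(i <- r | P i) F i.
Proof. by elim/big_rec: _. Qed.

Lemma dvdz_anti_ge0 (x y : int) :
  0 <= x -> 0 <= y -> (x %| y)%Z -> (y %| x)%Z -> x = y.
Proof.
move=> /gez0_abs <- /gez0_abs <- xy yx; congr Posz; apply/eqP.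
by rewrite eqn_dvd; apply/andP.
Qed.

Lemma lie_coef_gen_dvd_coord (d : Order.disp_t) (A : finOrderType d)
    (n : nat) (w : n.-tuple A) (xi : n.-tuple A -> int) :
  left_bracketing_adj (word w) =
    \sum_(t : n.-tuple A | lyndon t) xi t *: left_bracketing_adj (word t) ->
  forall s : n.-tuple A, lyndon s -> (lie_coef_gen w %| xi s)%Z.
Proof.
move=> hxi s.
(* Descending induction on [s], measured by the number of words of length [n] above it. *)
have [m] := ubnP #|[set t : n.-tuple A | s < t :> seqlexi A]%O|.
elim: m s => // m IH s sm ls.
have [R hR LR] := lyndon_lie (lyndon_lt_suffixes ls).
have := lie_coef_gen_dvd w LR.
have [Q eQ] := free_lie_in_image LR.
(* Since [word s + R = l(Q)], pairing [hxi] with [Q] turns adjoints of words into coefficients of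
   [word s + R]. *)
have -> : (word s + R)@_(FMonom w) =
    \sum_(t : n.-tuple A | lyndon t) xi t * (word s + R)@_(FMonom t).
  rewrite eQ coef_left_bracketing hxi.
  under eq_bigr do rewrite raddf_sum mulr_sumr /=.
  rewrite exchange_big; apply: eq_bigr => t _; rewrite coef_left_bracketing.
  rewrite mulr_sumr; apply: eq_bigr => u _; by rewrite mcoeffZ mulrCA.
rewrite (bigD1 s) //= mcoeffD mcoeffUU [R@__]mcoeff_outdom; last first.
  by apply/negP => /hR[_]; rewrite ltxx.
rewrite addr0 mulr1 rpredDr //; apply: rpred_sum => t /andP[lt ts].
(* Only words [t] in the support contribute; being different from [s], they lie above it. *)
have [st|st] := boolP (FMonom t \in msupp (word s + R)); last first.
  by rewrite mcoeff_outdom // mulr0 rpred0.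
have {}st : (s < t :> seqlexi A)%O.
  have [_] := supp_gt_word_size hR st.
  rewrite le_eqVlt => /orP[/eqP e|//].
  by case/eqP: ts; apply/val_inj.
apply: dvdz_mulr; apply: IH lt.
rewrite ltnS in sm; apply: leq_trans sm; apply: proper_card.
apply/properP; split.
  by apply/subsetP => x; rewrite !inE; apply: lt_trans.
by exists t; rewrite !inE ?ltxx.
Qed.

Theorem theorem2p5 (d : Order.disp_t) (A : finOrderType d)
    (n : nat) (w : n.-tuple A) (xi : n.-tuple A -> int)
    (hxi : left_bracketing_adj (word w) =
           \sum_(t : n.-tuple A | lyndon t) xi t *: left_bracketing_adj (word t)) :
  lie_coef_gen w = 0 \/
  (lie_coef_gen w =
     \big[gcdz/0]_(u <- msupp (left_bracketing_adj (word w)))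
        (left_bracketing_adj (word w))@_u /\
   lie_coef_gen w =
     \big[gcdz/0]_(t : n.-tuple A | lyndon t && (xi t != 0)) xi t).
Proof.
(* The second alternative covers [c(w) = 0] too: both gcds are then over empty families and equal
   0. *)
right; have [c0 _] := lie_coef_genP w.
split; apply: dvdz_anti_ge0 => //; try exact: biggcd_ge0.
- rewrite dvdz_biggcd; apply/allP => u _.
  by rewrite -[u]fmK; apply: lie_coef_gen_dvd_adj.
- apply: dvdz_lie_coef_gen => u; have := dvdzz (\big[gcdz/0]_(u <- msupp
    (left_bracketing_adj (word w))) (left_bracketing_adj (word w))@_u).
  rewrite dvdz_biggcd => /allP /(_ u).
  have [_ /(_ isT) //|/mcoeff_outdom -> _] :=
    boolP (u \in msupp (left_bracketing_adj (word w))).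
  exact: dvdz0.
- rewrite dvdz_biggcd; apply/allP => t _; apply/implyP => /andP[lt _].
  exact: lie_coef_gen_dvd_coord hxi t lt.
- apply: dvdz_lie_coef_gen => u; rewrite hxi raddf_sum /=.
  have := dvdzz (\big[gcdz/0]_(t : n.-tuple A | lyndon t && (xi t != 0)) xi t).
  rewrite dvdz_biggcd => /allP hg.
  apply: rpred_sum => t lt; rewrite mcoeffZ dvdz_mulr //.
  (* Coordinates left out of the gcd are 0, which everything divides. *)
  have [->|xt] := eqVneq (xi t) 0; first exact: dvdz0.
  by have := hg t (mem_index_enum t); rewrite lt xt.
Qed.
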